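(* Let $L$ be a frame, let $(P;e)$ be an $L$-complete lattice and $f:(P;e)\to(P;e)$ a monotone map. Define $S_f,T_f:P\to L$ by $S_f(x)=e(f(x),x)$ and $T_f(x)=e(x,f(x))$. Then $\sqcap S_f$ and $\sqcup T_f$ are fixpoints of $f$. Indeed, $\sqcap S_f$ is the least fixpoint and $\sqcup T_f$ is the greatest fixpoint of $f$ (with respect to the order $\le_e$ on $P$).
   Context: A frame is a complete lattice $L$ (with bottom $0$, top $1$) satisfying $a\wedge\bigvee S=\bigvee_{s\in S}(a\wedge s)$ for all $a\in L$, $S\subseteq L$; its relative pseudocomplement is $a\to b=\bigvee\{x\in L\mid a\wedge x\le b\}$. $L^P$ is the set of all maps $P\to L$. An $L$-ordered set is a pair $(P;e)$ with $P$ a set and $e:P\times P\to L$ a map such that for all $x,y,z\in P$: (E1) $e(x,x)=1$; (E2) $e(x,y)\wedge e(y,z)\le e(x,z)$; (E3) $e(x,y)=e(y,x)=1$ implies $x=y$. The relation $x\le_e y\iff e(x,y)=1$ is a partial order on $P$. For $S\in L^P$, an element $x_0\in P$ is the join of $S$, written $x_0=\sqcup S$, if for all $x\in P$: $S(x)\le e(x,x_0)$ and $\bigwedge_{y\in P}(S(y)\to e(y,x))\le e(x_0,x)$. It is the meet, $x_0=\sqcap S$, if for all $x\in P$: $S(x)\le e(x_0,x)$ and $\bigwedge_{y\in P}(S(y)\to e(x,y))\le e(x,x_0)$. Joins and meets are unique when they exist. $(P;e)$ is an $L$-complete lattice if $\sqcup S$ and $\sqcap S$ exist for every $S\in L^P$.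 A map $f:P\to P$ is monotone if $e(x,y)\le e(f(x),f(y))$ for all $x,y\in P$. A fixpoint of $f$ is an $x\in P$ with $f(x)=x$. *)

(* Defs.v *)
From HB Require Import structures.
From mathcomp Require Import all_boot all_order.
From mathcomp Require Import boolp classical_sets.

Set Implicit Arguments.
Unset Strict Implicit.
Unset Printing Implicit Defensive.

Import Order.TTheory.
Local Open Scope classical_set_scope.

HB.mixin Record TBLattice_isCompleteLattice (d : Order.disp_t) L
    of Order.TBLattice d L := {
  bigjoin : set L -> L;
  bigmeet : set L -> L;
  bigjoin_ub : forall (A : set L) (x : L), A x -> (x <= bigjoin A)%O;
  bigjoin_le : forall (A : set L) (b : L),
    (forall x, A x -> (x <= b)%O) -> (bigjoin A <= b)%O;
  bigmeet_lb : forall (A : set L) (x : L), A x -> (bigmeet A <= x)%O;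
  bigmeet_ge : forall (A : set L) (b : L),
    (forall x, A x -> (b <= x)%O) -> (b <= bigmeet A)%O
}.

#[short(type="completeLatticeType")]
HB.structure Definition CompleteLattice (d : Order.disp_t) :=
  { L of Order.TBLattice d L & TBLattice_isCompleteLattice d L }.

HB.mixin Record CompleteLattice_isFrame (d : Order.disp_t) L
    of CompleteLattice d L := {
  meet_bigjoin : forall (a : L) (A : set L),
    Order.meet a (bigjoin A) = bigjoin [set Order.meet a s | s in A]
}.

#[short(type="frameType")]
HB.structure Definition Frame (d : Order.disp_t) :=
  { L of CompleteLattice d L & CompleteLattice_isFrame d L }.

Definition rpc (d : Order.disp_t) (L : frameType d) (a b : L) : L :=
  bigjoin [set x | (Order.meet a x <= b)%O].

HB.mixin Record isLOrdered (d : Order.disp_t) (L : frameType d) (P : Type) := {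
  lrel : P -> P -> L;
  lrel_refl : forall x, lrel x x = (\top)%O;
  lrel_trans : forall x y z,
    (Order.meet (lrel x y) (lrel y z) <= lrel x z)%O;
  lrel_anti : forall x y, lrel x y = (\top)%O -> lrel y x = (\top)%O -> x = y
}.

#[short(type="lOrderedType")]
HB.structure Definition LOrdered (d : Order.disp_t) (L : frameType d) :=
  { P of isLOrdered d L P }.

Section LOrderedTheory.
Context {d : Order.disp_t} {L : frameType d} {P : lOrderedType L}.
Implicit Types (S : P -> L) (f : P -> P) (x : P).

Definition le_e (x y : P) : Prop := lrel x y = (\top)%O.

Definition is_ljoin S x0 : Prop := forall x,
  (S x <= lrel x x0)%O /\
  (bigmeet [set rpc (S y) (lrel y x) | y in [set: P]] <= lrel x0 x)%O.

Definition is_lmeet S x0 : Prop := forall x,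
  (S x <= lrel x0 x)%O /\
  (bigmeet [set rpc (S y) (lrel x y) | y in [set: P]] <= lrel x x0)%O.

Definition lmonotone f : Prop :=
  forall x y, (lrel x y <= lrel (f x) (f y))%O.

Definition fixpoint f x : Prop := f x = x.

Definition least_fixpoint f x : Prop :=
  fixpoint f x /\ forall y, fixpoint f y -> le_e x y.

Definition greatest_fixpoint f x : Prop :=
  fixpoint f x /\ forall y, fixpoint f y -> le_e y x.

Lemma is_ljoin_uniq S x0 x1 : is_ljoin S x0 -> is_ljoin S x1 -> x0 = x1.
Proof.
suff H u v : is_ljoin S u -> is_ljoin S v -> le_e u v.
  by move=> h0 h1; apply: lrel_anti; apply: H.
move=> hu hv; apply/le_anti; rewrite lex1 /=.
apply: le_trans (hu v).2; apply: bigmeet_ge => _ [y _ <-].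
by apply: bigjoin_ub; rewrite /= meetx1; exact: (hv y).1.
Qed.

Lemma is_lmeet_uniq S x0 x1 : is_lmeet S x0 -> is_lmeet S x1 -> x0 = x1.
Proof.
suff H u v : is_lmeet S u -> is_lmeet S v -> le_e v u.
  by move=> h0 h1; apply: lrel_anti; apply: H.
move=> hu hv; apply/le_anti; rewrite lex1 /=.
apply: le_trans (hu v).2; apply: bigmeet_ge => _ [y _ <-].
by apply: bigjoin_ub; rewrite /= meetx1; exact: (hv y).1.
Qed.

Definition S_ f : P -> L := fun x => lrel (f x) x.
Definition T_ f : P -> L := fun x => lrel x (f x).

End LOrderedTheory.

HB.mixin Record LOrdered_isLComplete (d : Order.disp_t) (L : frameType d) P
    of LOrdered d L P := {
  ex_ljoin : forall S : P -> L, exists x0 : P, is_ljoin S x0;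
  ex_lmeet : forall S : P -> L, exists x0 : P, is_lmeet S x0
}.

#[short(type="lCompleteType")]
HB.structure Definition LComplete (d : Order.disp_t) (L : frameType d) :=
  { P of LOrdered d L P & LOrdered_isLComplete d L P }.

Section LCompleteTheory.
Context {d : Order.disp_t} {L : frameType d} {P : lCompleteType L}.

(* The witnesses chosen below are canonical, by is_ljoin_uniq/is_lmeet_uniq. *)
Definition ljoin (S : P -> L) : P := projT1 (cid (ex_ljoin S)).
Definition lmeet (S : P -> L) : P := projT1 (cid (ex_lmeet S)).

Lemma ljoinP (S : P -> L) : is_ljoin S (ljoin S).
Proof. exact: projT2 (cid (ex_ljoin S)). Qed.

Lemma lmeetP (S : P -> L) : is_lmeet S (lmeet S).
Proof. exact: projT2 (cid (ex_lmeet S)). Qed.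

End LCompleteTheory.

(* Main.v *)
Require Import Defs.
From mathcomp Require Import all_boot all_order.
From mathcomp Require Import boolp classical_sets.

(** Let [m] be the meet of [S_ f]. Since [S_ f y <= lrel m y <= lrel (f m) (f y)],
    transitivity gives [S_ f y <= lrel (f m) y] for every [y], so [f m] is an
    [L]-lower bound of [S_ f] and [f m] is below [m]. By monotonicity
    [S_ f (f m)] is the top element, hence [m] is below [f m]. Every fixpoint
    [y] has [S_ f y] equal to top, so [m] is the least one. The argument for the
    join of [T_ f] is dual. *)

Set Implicit Arguments.
Unset Strict Implicit.

Import Order.TTheory.

Section LOrderedFixpoints.
Context {d : Order.disp_t} {L : frameType d} {P : lOrderedType L}.
Implicit Types (S : P -> L) (f : P -> P).

Lemma le_eP (x y : P) : (\top <= lrel x y)%O -> le_e x y.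
Proof. by rewrite le1x => /eqP. Qed.

(** The hypothesis puts [\top] in the set whose join is [rpc (S y) (lrel x y)], so the meet of these
    is top, and it lies below [lrel x m]. *)
Lemma is_lmeet_greatest S m x :
  is_lmeet S m -> (forall y, (S y <= lrel x y)%O) -> le_e x m.
Proof.
move=> hm hx; apply/le_eP/(le_trans _ (hm x).2).
apply: bigmeet_ge => _ [y _ <-].
by apply: bigjoin_ub; rewrite /= meetx1.
Qed.

Lemma is_ljoin_least S j x :
  is_ljoin S j -> (forall y, (S y <= lrel y x)%O) -> le_e j x.
Proof.
move=> hj hx; apply/le_eP/(le_trans _ (hj x).2).
apply: bigmeet_ge => _ [y _ <-].
by apply: bigjoin_ub; rewrite /= meetx1.
Qed.

Lemma lmonotone_le_e f x y : lmonotone f -> le_e x y -> le_e (f x) (f y).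
Proof. by move=> hf xy; apply: le_eP; rewrite -xy; exact: hf. Qed.

Lemma is_lmeet_least_fixpoint f m :
  lmonotone f -> is_lmeet (S_ f) m -> least_fixpoint f m.
Proof.
move=> hf hm.
have fm_m : le_e (f m) m.
  apply: (is_lmeet_greatest hm) => y.
  (* The factor [lrel (f y) y] is [S_ f y] itself; only [lrel (f m) (f y)] remains to be bounded. *)
  apply: le_trans (lrel_trans _ (f y) _); rewrite lexI lexx andbT.
  exact: le_trans (hm y).1 (hf _ _).
split; last by move=> y fy; apply: le_eP; have := (hm y).1; rewrite /S_ fy lrel_refl.
apply: (lrel_anti _ _ fm_m); apply: le_eP.
by rewrite -[\top%O](lmonotone_le_e hf fm_m); exact: (hm (f m)).1.
Qed.

Lemma is_ljoin_greatest_fixpoint f j :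
  lmonotone f -> is_ljoin (T_ f) j -> greatest_fixpoint f j.
Proof.
move=> hf hj.
have j_fj : le_e j (f j).
  apply: (is_ljoin_least hj) => y.
  apply: le_trans (lrel_trans _ (f y) _); rewrite lexI lexx /=.
  exact: le_trans (hj y).1 (hf _ _).
split; last by move=> y fy; apply: le_eP; have := (hj y).1; rewrite /T_ fy lrel_refl.
apply: (lrel_anti _ _ _ j_fj); apply: le_eP.
(* Top is rewritten backwards into [lrel (f j) (f (f j))], which is [T_ f (f j)]. *)
by rewrite -[\top%O](lmonotone_le_e hf j_fj); exact: (hj (f j)).1.
Qed.

End LOrderedFixpoints.

Theorem theorem3p5 (d : Order.disp_t) (L : frameType d) (P : lCompleteType L)
    (f : P -> P) (hf : lmonotone f) :
  fixpoint f (lmeet (S_ f)) /\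
  fixpoint f (ljoin (T_ f)) /\
  least_fixpoint f (lmeet (S_ f)) /\
  greatest_fixpoint f (ljoin (T_ f)).
Proof.
have hm := is_lmeet_least_fixpoint hf (lmeetP (S_ f)).
have hj := is_ljoin_greatest_fixpoint hf (ljoinP (T_ f)).
by split; [case: hm | split; [case: hj |]].
Qed.
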